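(* Let $(A,\rightarrow,\rightsquigarrow,0,1)$ be a good pseudo-BCK algebra satisfying the Glivenko property and let $\varphi$ be an interior operator on $A$. Define $\tilde{\varphi}:\mathrm{Reg}(A)\to\mathrm{Reg}(A)$ by $\tilde{\varphi}(x)=(\varphi(x))^{-\sim}$. Then $\tilde{\varphi}$ is an interior operator on $\mathrm{Reg}(A)$.
   Context: A pseudo-BCK algebra is a structure $(A,\leq,\rightarrow,\rightsquigarrow,1)$ where $\leq$ is a binary relation on $A$, $\rightarrow$ and $\rightsquigarrow$ are binary operations on $A$ and $1\in A$, such that for all $x,y,z\in A$: $x\rightarrow y\leq (y\rightarrow z)\rightsquigarrow (x\rightarrow z)$ and $x\rightsquigarrow y\leq (y\rightsquigarrow z)\rightarrow (x\rightsquigarrow z)$; $x\leq (x\rightarrow y)\rightsquigarrow y$ and $x\leq (x\rightsquigarrow y)\rightarrow y$; $x\leq x$; $x\leq 1$; if $x\leq y$ and $y\leq x$ then $x=y$; $x\leq y$ iff $x\rightarrow y=1$ iff $x\rightsquigarrow y=1$. It is bounded if there is an element $0\in A$ with $0\leq x$ for all $x\in A$; it is then written $(A,\rightarrow,\rightsquigarrow,0,1)$, and one sets $x^{-}:=x\rightarrow 0$, $x^{\sim}:=x\rightsquigarrow 0$, $x^{-\sim}:=(x^{-})^{\sim}$, $x^{\sim-}:=(x^{\sim})^{-}$. A bounded pseudo-BCK algebra $A$ is good if $x^{-\sim}=x^{\sim-}$ for all $x\in A$. A good pseudo-BCK algebra has the Glivenko property if $(x\rightarrow y)^{-\sim}=x\rightarrow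 y^{-\sim}$ and $(x\rightsquigarrow y)^{-\sim}=x\rightsquigarrow y^{-\sim}$ for all $x,y\in A$. $\mathrm{Reg}(A)=\{x\in A\mid x^{-\sim}=x^{\sim-}=x\}$; under the Glivenko property it is a subalgebra $(\mathrm{Reg}(A),\rightarrow,\rightsquigarrow,0,1)$ of $A$, hence itself a bounded pseudo-BCK algebra. An interior operator on a pseudo-BCK algebra $A$ is a map $\varphi:A\to A$ such that for all $x,y\in A$: $\varphi(x)\leq x$; $x\leq y$ implies $\varphi(x)\leq\varphi(y)$; $\varphi(\varphi(x))=\varphi(x)$. *)

(* Defs.v *)
From Stdlib Require Import ProofIrrelevance.

Set Implicit Arguments.
Unset Strict Implicit.
Unset Printing Implicit Defensive.

Declare Scope pbck_scope.
Delimit Scope pbck_scope with pbck.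

Record pseudoBCK := PseudoBCK {
  carrier :> Type;
  le : carrier -> carrier -> Prop;
  imp : carrier -> carrier -> carrier;
  simp : carrier -> carrier -> carrier;
  one : carrier;
  imp_le_simp : forall x y z,
    le (imp x y) (simp (imp y z) (imp x z));
  simp_le_imp : forall x y z,
    le (simp x y) (imp (simp y z) (simp x z));
  le_imp_simp : forall x y, le x (simp (imp x y) y);
  le_simp_imp : forall x y, le x (imp (simp x y) y);
  le_refl : forall x, le x x;
  le_one : forall x, le x one;
  le_antisym : forall x y, le x y -> le y x -> x = y;
  le_impE : forall x y, le x y <-> imp x y = one;
  le_simpE : forall x y, le x y <-> simp x y = one
}.

Arguments one {_}.

Notation "x ≼ y" := (le x y) (at level 70, no associativity) : pbck_scope.
Notation "x ⟶ y" := (imp x y) (at level 55, right associativity) : pbck_scope.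
Notation "x ⇝ y" := (simp x y) (at level 55, right associativity) : pbck_scope.
Open Scope pbck_scope.

Record boundedPseudoBCK := BoundedPseudoBCK {
  pseudoBCK_of :> pseudoBCK;
  zero : pseudoBCK_of;
  zero_le : forall x : pseudoBCK_of, zero ≼ x
}.

Arguments zero {_}.

Notation "x '⁻'" := (x ⟶ zero)
  (at level 2, left associativity, format "x '⁻'") : pbck_scope.
Notation "x '˜'" := (x ⇝ zero)
  (at level 2, left associativity, format "x '˜'") : pbck_scope.

Definition good (A : boundedPseudoBCK) : Prop :=
  forall x : A, x⁻˜ = x˜⁻.

Definition glivenko (A : boundedPseudoBCK) : Prop :=
  (forall x y : A, (x ⟶ y)⁻˜ = x ⟶ y⁻˜) /\
  (forall x y : A, (x ⇝ y)⁻˜ = x ⇝ y⁻˜).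

Definition interior_operator (A : pseudoBCK) (phi : A -> A) : Prop :=
  (forall x : A, phi x ≼ x) /\
  (forall x y : A, x ≼ y -> phi x ≼ phi y) /\
  (forall x : A, phi (phi x) = phi x).

Arguments interior_operator : clear implicits.

Definition regular (A : boundedPseudoBCK) (x : A) : Prop :=
  x⁻˜ = x /\ x˜⁻ = x.

Definition Reg (A : boundedPseudoBCK) : Type := {x : A | regular x}.

Section BasicFacts.
Variable A : pseudoBCK.
Implicit Types x y z : A.

Lemma one_le x : one ≼ x -> x = one.
Proof. intro H; apply le_antisym; [apply le_one | exact H]. Qed.

Lemma imp_antitone x y z : x ≼ y -> y ⟶ z ≼ x ⟶ z.
Proof.
intro H; apply le_simpE, one_le.
rewrite <- (proj1 (le_impE x y) H); apply imp_le_simp.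
Qed.

Lemma simp_antitone x y z : x ≼ y -> y ⇝ z ≼ x ⇝ z.
Proof.
intro H; apply le_impE, one_le.
rewrite <- (proj1 (le_simpE x y) H); apply simp_le_imp.
Qed.

End BasicFacts.

Section Regular.
Variable A : boundedPseudoBCK.
Hypothesis Agood : good A.
Implicit Types x y : A.

Lemma neg3 x : x⁻˜⁻ = x⁻.
Proof.
apply le_antisym; [apply imp_antitone, le_imp_simp | apply le_simp_imp].
Qed.

Lemma good_regular x : x⁻˜ = x -> regular x.
Proof. intro H; split; [exact H | rewrite <- Agood; exact H]. Qed.

Lemma regular_dneg x : regular x⁻˜.
Proof. apply good_regular; rewrite neg3; reflexivity. Qed.

Lemma regular_one : regular (one : A).
Proof. apply good_regular, one_le, le_imp_simp. Qed.

Lemma regular_zero : regular (zero : A).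
Proof.
apply good_regular, le_antisym; [| apply zero_le].
rewrite (proj1 (le_impE zero zero) (le_refl zero)).
apply le_impE, one_le, le_simp_imp.
Qed.

Hypothesis Aglivenko : glivenko A.

Lemma regular_imp x y : regular y -> regular (x ⟶ y).
Proof.
intros [Hy _]; apply good_regular.
rewrite (proj1 Aglivenko), Hy; reflexivity.
Qed.

Lemma regular_simp x y : regular y -> regular (x ⇝ y).
Proof.
intros [Hy _]; apply good_regular.
rewrite (proj2 Aglivenko), Hy; reflexivity.
Qed.

End Regular.

Section RegAlgebra.
Variable A : boundedPseudoBCK.
Hypotheses (Agood : good A) (Aglivenko : glivenko A).

(* Proof irrelevance makes equality in the subtype [Reg A] coincide with
   equality in [A]; antisymmetry of the restricted order needs this. *)
Lemma Reg_eq (x y : Reg A) : proj1_sig x = proj1_sig y -> x = y.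
Proof.
destruct x as [x Hx], y as [y Hy]; simpl; intro H.
apply subset_eq_compat; exact H.
Qed.

Definition Reg_le (x y : Reg A) : Prop := proj1_sig x ≼ proj1_sig y.

Definition Reg_imp (x y : Reg A) : Reg A :=
  exist _ (proj1_sig x ⟶ proj1_sig y)
    (regular_imp Agood Aglivenko (proj1_sig x) (proj2_sig y)).

Definition Reg_simp (x y : Reg A) : Reg A :=
  exist _ (proj1_sig x ⇝ proj1_sig y)
    (regular_simp Agood Aglivenko (proj1_sig x) (proj2_sig y)).

Definition Reg_one : Reg A := exist _ one (regular_one Agood).

Definition Reg_zero : Reg A := exist _ zero (regular_zero Agood).

Lemma Reg_le_antisym (x y : Reg A) : Reg_le x y -> Reg_le y x -> x = y.
Proof. intros Hxy Hyx; apply Reg_eq, le_antisym; assumption. Qed.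

Lemma Reg_le_impE (x y : Reg A) : Reg_le x y <-> Reg_imp x y = Reg_one.
Proof.
split; intro H.
- apply Reg_eq; simpl; apply le_impE; exact H.
- apply le_impE; exact (f_equal (@proj1_sig _ _) H).
Qed.

Lemma Reg_le_simpE (x y : Reg A) : Reg_le x y <-> Reg_simp x y = Reg_one.
Proof.
split; intro H.
- apply Reg_eq; simpl; apply le_simpE; exact H.
- apply le_simpE; exact (f_equal (@proj1_sig _ _) H).
Qed.

Definition Reg_pseudoBCK : pseudoBCK :=
  @PseudoBCK (Reg A) Reg_le Reg_imp Reg_simp Reg_one
    (fun x y z => imp_le_simp (proj1_sig x) (proj1_sig y) (proj1_sig z))
    (fun x y z => simp_le_imp (proj1_sig x) (proj1_sig y) (proj1_sig z))
    (fun x y => le_imp_simp (proj1_sig x) (proj1_sig y))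
    (fun x y => le_simp_imp (proj1_sig x) (proj1_sig y))
    (fun x => le_refl (proj1_sig x))
    (fun x => le_one (proj1_sig x))
    Reg_le_antisym Reg_le_impE Reg_le_simpE.

Definition Reg_algebra : boundedPseudoBCK :=
  @BoundedPseudoBCK Reg_pseudoBCK Reg_zero (fun x => zero_le (proj1_sig x)).

End RegAlgebra.

Definition phi_tilde (A : boundedPseudoBCK) (Agood : good A) (phi : A -> A)
    (x : Reg A) : Reg A :=
  exist _ (phi (proj1_sig x))⁻˜ (regular_dneg Agood (phi (proj1_sig x))).

(* Main.v *)
Require Import Defs.

(** Double negation [x⁻˜] is a closure operator whose fixed points are the
    regular elements: it is monotone because both negations are antitone
    ([dneg_mono]), and it is extensive by [le_imp_simp].  Contraction and
    monotonicity pass from [phi] to its double negation by monotonicity of the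
    closure.  For idempotence, one inequality is contraction; for the other,
    [phi x] is a fixed point of [phi] lying below [(phi x)⁻˜], hence
    [phi x = phi (phi x) ≼ phi ((phi x)⁻˜)], and closing both sides gives the
    claim. *)

Lemma dneg_mono (A : boundedPseudoBCK) (x y : A) : x ≼ y -> x⁻˜ ≼ y⁻˜.
Proof. intro H; apply simp_antitone, imp_antitone, H. Qed.

Theorem proposition3p7 (A : boundedPseudoBCK) (Agood : good A)
    (Aglivenko : glivenko A) (phi : A -> A)
    (phi_int : interior_operator A phi) :
  interior_operator (Reg_algebra Agood Aglivenko) (phi_tilde Agood phi).
Proof.
destruct phi_int as [phi_le [phi_mono phi_idem]].
assert (contract : forall x : Reg A,
          proj1_sig (phi_tilde Agood phi x) ≼ proj1_sig x).
{ intros [x [Hx Hx']]; simpl.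
  pose proof (dneg_mono A _ _ (phi_le x)) as H.
  rewrite Hx in H; exact H. }
split; [exact contract | split].
- intros x y Hxy; exact (dneg_mono A _ _ (phi_mono _ _ Hxy)).
- intro x; apply Reg_eq, le_antisym; [apply contract | simpl].
  pose proof (phi_mono _ _ (le_imp_simp (phi (proj1_sig x)) zero)) as H.
  rewrite phi_idem in H; apply dneg_mono, H.
Qed.
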